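(* One has $b_t(G_{6,4})=2$, and for any integer $n\geq 1$: (i) $b_t(G_{n,4})=1$ if $n\equiv 1\pmod 5$ and $n\neq 6$; (ii) $b_t(G_{n,4})=2$ if $n\equiv 4\pmod 5$; (iii) $b_t(G_{n,4})\leq 3$ if $n\equiv 2\pmod 5$; (iv) $b_t(G_{n,4})\leq 4$ if $n\equiv 0\pmod 5$ or $n\equiv 3\pmod 5$.
   Context: All graphs are finite, undirected, without loops or multiple edges. For positive integers $n,m$, the $(n,m)$-grid graph $G_{n,m}=P_n\times P_m$ is the Cartesian product of the paths $P_n$ and $P_m$: its vertex set is $\{x_{ij} : 1\le i\le n,\ 1\le j\le m\}$, and $x_{ij}$ and $x_{i'j'}$ are adjacent if and only if either $i=i'$ and $|j-j'|=1$, or $j=j'$ and $|i-i'|=1$. For a graph $G$ without isolated vertices, a total dominating set of $G$ is a set $D\subseteq V(G)$ such that every vertex of $G$ (including those in $D$) has at least one neighbor in $D$. The total domination number $\gamma_t(G)$ is the minimum cardinality of a total dominating set of $G$. The total bondage number $b_t(G)$ of a graph $G$ without isolated vertices is the minimum cardinality of a set $B\subseteq E(G)$ of edges such that the graph $G-B$ obtained by removing the edges in $B$ (keeping all vertices) has no isolated vertices and satisfies $\gamma_t(G-B)>\gamma_t(G)$; if no such $B$ exists, $b_t(G)=\infty$. *)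

(* Defs.v *)
From mathcomp Require Import all_boot.

Set Implicit Arguments.
Unset Strict Implicit.
Unset Printing Implicit Defensive.

Record sgraph := SGraph {
  vertex :> finType;
  adj : rel vertex;
  adj_sym : symmetric adj;
  adj_irrefl : irreflexive adj
}.

Section TotalBondage.

Variable G : sgraph.

(* An edge is the unordered pair of its two (distinct) endpoints. *)
Definition edges : {set {set G}} :=
  [set [set x; y] | x in [set: G], y in [set: G] & adj x y].

Definition del_adj (B : {set {set G}}) : rel G :=
  fun x y => adj x y && ([set x; y] \notin B).

Lemma del_adj_sym B : symmetric (del_adj B).
Proof. by move=> x y; rewrite /del_adj adj_sym setUC. Qed.

Lemma del_adj_irrefl B : irreflexive (del_adj B).
Proof. by move=> x; rewrite /del_adj adj_irrefl. Qed.

Definition del_edges (B : {set {set G}}) : sgraph :=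
  SGraph (del_adj_sym B) (del_adj_irrefl B).

Definition no_isolated : bool := [forall x : G, exists y : G, adj x y].

Definition total_dominating (D : {set G}) : bool :=
  [forall x : G, exists y in D, adj x y].

(* The whole vertex set is total dominating exactly when G has no isolated
   vertex; the value is meaningful only in that case (see gamma_tP). *)
Definition gamma_t : nat :=
  #|[arg min_(D < [set: G] | total_dominating D) #|D|]|.

End TotalBondage.

Definition total_bondage_set (G : sgraph) (B : {set {set G}}) : bool :=
  [&& B \subset edges G, no_isolated (del_edges B)
    & gamma_t G < gamma_t (del_edges B)].

(* None stands for infinity. *)
Definition total_bondage (G : sgraph) : option nat :=
  if [pick B | @total_bondage_set G B] is Some B0
  then Some #|[arg min_(B < B0 | @total_bondage_set G B) #|B|]|
  else None.

Definition bondage_le (b : option nat) (k : nat) : bool :=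
  if b is Some c then c <= k else false.

(* Coordinates are numbered from 0, so x_{ij} is the pair (i - 1, j - 1). *)
Definition grid_adj (n m : nat) : rel ('I_n * 'I_m) :=
  let consecutive (a b : nat) := (a.+1 == b) || (b.+1 == a) in
  fun x y => ((x.1 == y.1) && consecutive x.2 y.2)
          || ((x.2 == y.2) && consecutive x.1 y.1).

Lemma grid_adj_sym n m : symmetric (@grid_adj n m).
Proof.
move=> x y; rewrite /grid_adj /= (eq_sym x.1) (eq_sym x.2).
by rewrite (orbC (x.2.+1 == _)) (orbC (x.1.+1 == _)).
Qed.

Lemma grid_adj_irrefl n m : irreflexive (@grid_adj n m).
Proof. by move=> x; rewrite /grid_adj /= !(gtn_eqF (ltnSn _)) !andbF. Qed.

Definition grid (n m : nat) : sgraph :=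
  SGraph (@grid_adj_sym n m) (@grid_adj_irrefl n m).

Lemma gamma_tP (G : sgraph) (k : nat) : no_isolated G ->
  gamma_t G = k <->
  (exists2 D : {set G}, total_dominating D & #|D| = k) /\
  (forall D : {set G}, total_dominating D -> k <= #|D|).
Proof.
move=> /forallP isoG; rewrite /gamma_t; case: arg_minnP => [|D tdD minD].
  apply/forallP=> x; have /existsP[y xy] := isoG x.
  by apply/existsP; exists y; rewrite inE.
split=> [<-|[[D' tdD' <-] minD']]; first by split=> //; exists D.
by apply/eqP; rewrite eqn_leq minD ?minD'.
Qed.

Lemma total_bondageP (G : sgraph) (k : nat) :
  total_bondage G = Some k <->
  (exists2 B : {set {set G}}, total_bondage_set B & #|B| = k) /\
  (forall B : {set {set G}}, total_bondage_set B -> k <= #|B|).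
Proof.
rewrite /total_bondage; case: pickP => [B0 bB0|noB]; last first.
  by split=> // -[[B bB _] _]; rewrite noB in bB.
case: arg_minnP => // B bB minB.
split=> [[<-]|[[B' bB' <-] minB']]; first by split=> //; exists B.
by congr Some; apply/eqP; rewrite eqn_leq minB ?minB'.
Qed.

(* Main.v *)
Require Import Defs.
From mathcomp Require Import all_boot.
From mathcomp Require Import zify.

(** Colour the cell (i, j) by the parity of i + j. Neighbours have opposite
colours, so a total dominating set D splits: its part of colour c has to
dominate the cells of the other colour, and the two requirements do not
interact, whichever edges have been removed. Each of these two halves is a
shortest word problem. A row of the grid holds two dominators of colour c, one
in an outer column (0 or 3) and one in an inner column (1 or 2), so that part
of D is a word of n letters in bool * bool; and whether the two targets of row
i are dominated depends only on the letters i - 1, i, i + 1. Rows alternate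
between two mirror images of one another, and in terms of outer and inner
columns the constraint of a row does not depend on the row, except that an
edge removed from the grid is one bit removed from the constraint of the row of
its target. Hence [gamma_t_value]: gamma_t (G - B) is the sum of the least
weights of two words, computed by a (min, +) recursion on tables indexed by
pairs of letters ([value_le], [value_attained]).

The recursion step commutes with adding a constant to a table, and five steps
with intact rows eventually add 3 to the table ([free_period], [cut_period]).
So adding five rows to a long grid adds 3 to the least weight of each half,
without removed edges, with removed edges in the top two rows, and also with a
single missing bit in an arbitrary row, because the new rows can be inserted on
the longer side of it. All the claims thereby become finite.

The upper bounds come from edges of the top two rows, here drawn with M, C, S
and T on them:
<<
      o-C-o-M-o---o
      |   |   |   T
      o-S-o---o---o
>>
Removing M, or M and T, or M, C and S, or all four edges raises gamma_t when n
is 1 (with n <> 6), 4, 2, or 0 or 3 modulo 5, respectively, as the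
tables show for n < 14 and the period for all n ([raises_all]). The pair
M, T works for n = 6 too. For the lower bound 2 when n is 4 modulo 5 or
n = 6, an edge has exactly one endpoint of each colour, so its removal deletes
one bit of one constraint in each half, and no such deletion changes the least
weight of a word ([cut_harmless]).
*)

Set Implicit Arguments.
Unset Strict Implicit.
Unset Printing Implicit Defensive.

(** * Shortest words under row constraints *)

(** The dominators of one colour in a row: the one in an outer column, then
the one in an inner column. *)
Definition letter := (bool * bool)%type.
Definition blank : letter := (false, false).
Definition letters : seq letter :=
  [:: (false, false); (true, false); (false, true); (true, true)].
Definition weight (a : letter) : nat := a.1 + a.2.

(** The edges that are left at the two targets of a row. For the target in an
inner column: those to the outer and to the inner dominator of the row, and
those going up and down. For the target in an outer column: the one to the
inner dominator, and those going up and down. *)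
Definition row := (bool * bool * bool * bool * (bool * bool * bool))%type.

(** The letter of the row is [b], those above and below are [a] and [c]. Going
up or down keeps the column, so an inner target meets inner dominators there
and an outer target meets outer ones. *)
Definition row_ok (r : row) (a b c : letter) : bool :=
  let: (i_outer, i_inner, i_up, i_down, (o_inner, o_up, o_down)) := r in
  [|| i_outer && b.1, i_inner && b.2, i_up && a.2 | i_down && c.2]
  && [|| o_inner && b.2, o_up && a.1 | o_down && c.1].

(** The word [w] of the rows [rs], below a row with letter [a]; it must be
followed by a blank letter, which stands for the missing row below the grid. *)
Fixpoint fits (rs : seq row) (a : letter) (w : nat -> letter) : bool :=
  if rs is r :: rs' then
    row_ok r a (w 0) (w 1) && fits rs' (w 0) (fun i => w i.+1)
  else w 0 == blank.

Definition cost n (w : nat -> letter) := \sum_(i < n) weight (w i).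

Lemma fitsP rs a w :
  reflect (w (size rs) = blank /\
           forall i r, i < size rs ->
             row_ok (nth r rs i) (if i is j.+1 then w j else a) (w i) (w i.+1))
          (fits rs a w).
Proof.
elim: rs a w => [|r rs IH] a w /=.
  by apply: (iffP eqP) => [->|[->]].
apply: (iffP andP) => [[ok0 /IH[wn ok]]|[wn ok]].
  by split=> // -[|i] r' //= lti; have := ok i r' lti; case: (i).
split; first exact: (ok 0 r).
by apply/IH; split=> // i r' lti; have := ok i.+1 r' lti; case: (i).
Qed.

(** In minima of weights, [None] is infinity. *)
Definition omin (x y : option nat) : option nat :=
  if x is Some m then if y is Some k then Some (minn m k) else x else y.
Definition best : seq (option nat) -> option nat := foldr omin None.
Definition oadd m : option nat -> option nat := omap (addn m).

Lemma best_mem s m : best s = Some m -> Some m \in s.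
Proof.
elim: s m => //= [[k|] s IH] m.
  case E: (best s) => [k'|] /= [<-]; rewrite inE ?eqxx //.
  case: leqP => _; first by rewrite eqxx.
  by rewrite IH ?orbT.
by move/IH; rewrite inE.
Qed.

Lemma best_le s k : Some k \in s -> exists2 m, best s = Some m & m <= k.
Proof.
elim: s => //= x s IH; rewrite inE => /orP[/eqP <-|/IH[m -> lemk]] /=.
  by case: (best s) => [k'|]; [exists (minn k k'); rewrite ?geq_minl|exists k].
case: x => [k'|]; last by exists m.
by exists (minn k' m) => //; apply: leq_trans (geq_minr _ _) lemk.
Qed.

Lemma best_oadd m s : best [seq oadd m x | x <- s] = oadd m (best s).
Proof.
elim: s => //= x s ->; case: x (best s) => [k|] [k'|] //=.
by rewrite addn_minr.
Qed.

(** A function of two letters is kept as the list of its sixteen values, so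
that iterating [step] computes each value once. *)
Definition table := seq (option nat).
Definition states : seq (letter * letter) :=
  [seq (a, b) | a <- letters, b <- letters].
Definition tabulate (f : letter -> letter -> option nat) : table :=
  [seq f s.1 s.2 | s <- states].
Definition code (a : letter) : nat := a.1 + 2 * a.2.
Definition look (t : table) (a b : letter) : option nat :=
  nth None t (4 * code a + code b).

Lemma look_tabulate f a b : look (tabulate f) a b = f a b.
Proof. by case: a b => [[] []] [[] []]. Qed.

Lemma mem_letters a : a \in letters.
Proof. by case: a => [[] []]. Qed.

(** If [t] gives, for letters [b] and [c], the least weight of a word that
starts with [c] and comes below [b], then [step r t] does so for words with one
more row, of constraint [r], on top. *)
Definition step (r : row) (t : table) : table :=
  tabulate (fun a b =>
    oadd (weight b) (best [seq look t b c | c <- letters & row_ok r a b c])).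
Definition final : table :=
  tabulate (fun _ b => if b == blank then Some 0 else None).
Definition opt : seq row -> table := foldr step final.
Definition start (t : table) : option nat := best [seq look t blank b | b <- letters].
Definition value (rs : seq row) : option nat := start (opt rs).

Lemma cost_recl n w : cost n.+1 w = weight (w 0) + cost n (fun i => w i.+1).
Proof. by rewrite /cost big_ord_recl. Qed.

Lemma opt_le rs a w : fits rs a w ->
  exists2 m, look (opt rs) a (w 0) = Some m & m <= cost (size rs) w.
Proof.
elim: rs a w => [|r rs IH] a w /=.
  by move=> w0; rewrite look_tabulate w0; exists 0.
case/andP=> ok0 /IH[m Em lem].
rewrite look_tabulate cost_recl.
have /best_le[k -> lek] : Some m \in
    [seq look (opt rs) (w 0) c | c <- letters & row_ok r a (w 0) c].
  by rewrite -Em; apply: map_f; rewrite mem_filter ok0 mem_letters.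
by exists (weight (w 0) + k); rewrite // leq_add2l (leq_trans lek).
Qed.

Lemma opt_attained rs a b m : look (opt rs) a b = Some m ->
  exists w, [/\ w 0 = b, fits rs a w & cost (size rs) w = m].
Proof.
elim: rs a b m => [|r rs IH] a b m; rewrite /= look_tabulate.
  case: eqP => // -> [<-]; exists (fun=> blank); split=> //.
  by rewrite /cost big_ord0.
case E: (best _) => [k|] //= [<-].
case/mapP: (best_mem E) => c; rewrite mem_filter => /andP[ok _] /esym.
case/IH=> w [w0 fw cw]; exists (fun i => if i is j.+1 then w j else b).
by split; rewrite //= ?cost_recl ?cw // w0 ok.
Qed.

Lemma value_le rs w : fits rs blank w ->
  exists2 m, value rs = Some m & m <= cost (size rs) w.
Proof.
case/opt_le=> m Em lem.
have /best_le[k Ek lek] : Some m \in [seq look (opt rs) blank b | b <- letters].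
  by rewrite -Em map_f ?mem_letters.
by exists k; rewrite // (leq_trans lek).
Qed.

Lemma value_attained rs m : value rs = Some m ->
  exists2 w, fits rs blank w & cost (size rs) w = m.
Proof.
by case/best_mem/mapP=> b _ /esym/opt_attained[w [_ fw cw]]; exists w.
Qed.

Definition shift m (t : table) : table := [seq oadd m x | x <- t].

Lemma look_shift m t a b : look (shift m t) a b = oadd m (look t a b).
Proof.
rewrite /look; set i := _ + _; have [lti|lei] := ltnP i (size t).
  exact: nth_map.
by rewrite !nth_default ?size_map.
Qed.

Lemma start_shift m t : start (shift m t) = oadd m (start t).
Proof.
by rewrite /start -best_oadd -map_comp; congr best; apply: eq_map => b /=;
  rewrite look_shift.
Qed.

(** The step is linear over (min, +): this is why a period of the tables, once
observed, persists. *)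
Lemma step_shift m r t : step r (shift m t) = shift m (step r t).
Proof.
rewrite /step /shift /tabulate -map_comp; apply: eq_map => -[a b] /=.
have -> : [seq look (shift m t) b c | c <- letters & row_ok r a b c] =
    [seq oadd m x | x <- [seq look t b c | c <- letters & row_ok r a b c]].
  by rewrite -map_comp; apply: eq_map => c /=; rewrite look_shift.
by rewrite best_oadd; case: (best _) => //= k; rewrite addnCA.
Qed.

Lemma iter_step_shift n m r t :
  iter n (step r) (shift m t) = shift m (iter n (step r) t).
Proof. by elim: n => //= n ->; rewrite step_shift. Qed.

(** * From the grid to its two halves *)

(** The columns of the dominators in a row, where [b] tells whether these are
the odd columns; the targets then have the columns for [~~ b]. *)
Definition outer (b : bool) : nat := if b then 3 else 0.
Definition inner (b : bool) : nat := if b then 1 else 2.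

(** A set of removed edges, in terms of coordinates: numbers compute, whereas
ordinals and sets do not. *)
Definition cutting := nat * nat -> nat * nat -> bool.

(** In row [i] the dominators of colour [c] have the columns of parity
[odd i (+) c]. For [i = 0] the bits for the edges going up are meaningless, but
they only ever meet the blank letter above the grid. *)
Definition row_of (k : cutting) (c : bool) (i : nat) : row :=
  let b := odd i (+) c in
  let s := (i, inner (~~ b)) in
  let t := (i, outer (~~ b)) in
  (~~ k s (i, outer b), ~~ k s (i, inner b), ~~ k s (i.-1, s.2),
   ~~ k s (i.+1, s.2),
   (~~ k t (i, inner b), ~~ k t (i.-1, t.2), ~~ k t (i.+1, t.2))).

Definition rows (k : cutting) (c : bool) (n : nat) : seq row :=
  [seq row_of k c i | i <- iota 0 n].

Lemma size_rows k c n : size (rows k c n) = n.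
Proof. by rewrite size_map size_iota. Qed.

Lemma nth_rows k c n r i : i < n -> nth r (rows k c n) i = row_of k c i.
Proof. by move=> ltin; rewrite (nth_map 0) ?size_iota // nth_iota. Qed.

Definition pos n (x : grid n 4) : nat * nat := (x.1 : nat, x.2 : nat).

Lemma pos_inj n : injective (@pos n).
Proof.
by case=> i j [i' j'] [/val_inj ei /val_inj ej]; move: ei ej => /= -> ->.
Qed.

Definition agree n (B : {set {set grid n 4}}) (k : cutting) : Prop :=
  forall x y : grid n 4, adj x y -> ([set x; y] \in B) = k (pos x) (pos y).

Definition nbrs (p : nat * nat) : seq (nat * nat) :=
  [:: (p.1, p.2.+1), (p.1.+1, p.2)
    & (if p.2 is j.+1 then [:: (p.1, j)] else [::])
      ++ (if p.1 is i.+1 then [:: (i, p.2)] else [::])].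

Lemma grid_adjE n (x y : grid n 4) : adj x y = (pos y \in nbrs (pos x)).
Proof.
rewrite /nbrs /pos /= /grid_adj -!val_eqE.
case: x y => [[i lti] [j ltj]] [[i' lti'] [j' ltj']] /=.
by case: i lti => [|i] lti; case: j ltj => [|j] ltj; rewrite /= !inE !xpair_eqE;
  lia.
Qed.

Section Halves.

Variables (n : nat) (B : {set {set grid n 4}}) (k : cutting).
Hypothesis Bk : agree B k.

Definition present (D : {set grid n 4}) (p : nat * nat) : bool :=
  [exists x in D, pos x == p].

Lemma present_pos D x : present D (pos x) = (x \in D).
Proof.
apply/exists_inP/idP => [[y yD /eqP/pos_inj <-]//|xD].
by exists x.
Qed.

Lemma present_out D i j : (n <= i) || (3 < j) -> present D (i, j) = false.
Proof.
move=> out; apply/negbTE/exists_inP => -[[[i' lti] [j' ltj]] _].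
by rewrite /pos /= xpair_eqE => /andP[/eqP ei /eqP ej]; move: out; lia.
Qed.

Definition reached (D : {set grid n 4}) (p : nat * nat) : bool :=
  has (fun q => ~~ k p q && present D q) (nbrs p).

Lemma total_dominatingE (D : {set grid n 4}) :
  total_dominating (G := del_edges B) D = [forall x : grid n 4, reached D (pos x)].
Proof.
apply: eq_forallb => x; apply/exists_inP/hasP => [[y yD]|[p]].
  rewrite /= /del_adj => /andP[xy]; rewrite Bk // => kxy.
  by exists (pos y); rewrite -?grid_adjE // kxy present_pos.
move=> px /andP[kp /exists_inP[y yD /eqP ep]].
exists y => //; rewrite /= /del_adj.
by rewrite -ep -grid_adjE in px; rewrite Bk px //= ep.
Qed.

Definition word (D : {set grid n 4}) (c : bool) (i : nat) : letter :=
  let b := odd i (+) c in (present D (i, outer b), present D (i, inner b)).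

Lemma word_out D c : word D c n = blank.
Proof. by rewrite /word !present_out ?leqnn. Qed.

(** Passing to the next row exchanges the columns of dominators and of
targets, so the vertical neighbours of an inner (outer) target are the inner
(outer) dominators of the next rows. *)
Lemma row_okE D c i :
  row_ok (row_of k c i) (if i is j.+1 then word D c j else blank)
    (word D c i) (word D c i.+1)
  = reached D (i, inner (~~ (odd i (+) c)))
    && reached D (i, outer (~~ (odd i (+) c))).
Proof.
have out : present D (i, 4) = false by rewrite present_out // orbT.
case: i out => [|i] out; rewrite /word /row_of /reached /nbrs /= ?addNb ?negbK.
  case: c; rewrite /= ?out ?andbF ?orbF //=; congr (_ && _);
    lia.
case: (odd i (+) c); rewrite /= ?out ?andbF ?orbF //=; congr (_ && _);
  lia.
Qed.

Lemma dominating_fits D c :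
  total_dominating (G := del_edges B) D -> fits (rows k c n) blank (word D c).
Proof.
rewrite total_dominatingE => /forallP domD; apply/fitsP.
rewrite size_rows word_out; split=> // i r ltin.
rewrite nth_rows // row_okE.
have reach j (ltj : j < 4) : reached D (i, j).
  exact: domD (Ordinal ltin, Ordinal ltj).
by rewrite !reach //; case: (odd i (+) c).
Qed.

Lemma fits_dominating D :
    (forall c, fits (rows k c n) blank (word D c)) ->
  total_dominating (G := del_edges B) D.
Proof.
move=> fitD; rewrite total_dominatingE; apply/forallP => -[[i lti] [j ltj]].
have /fitsP[_ /(_ i (row_of k false 0))] := fitD (~~ (odd i (+) odd j)).
rewrite size_rows nth_rows // row_okE => /(_ lti).
rewrite addbN addbA addbb addFb negbK /pos /= => /andP[].
by case: j ltj => [|[|[|[|]]]].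
Qed.

(** The two words of [D] account for all of its cells, as each row has an outer
and an inner dominator of both colours. *)
Lemma card_word (D : {set grid n 4}) :
  #|D| = cost n (word D false) + cost n (word D true).
Proof.
rewrite -sum1_card big_mkcond /= /cost -big_split /=.
rewrite (eq_bigr (fun x : 'I_n * 'I_4 =>
    nat_of_bool (present D (x.1 : nat, x.2 : nat)))).
  rewrite -(pair_big xpredT xpredT (fun (i : 'I_n) (j : 'I_4) =>
      nat_of_bool (present D (i : nat, j : nat)))) /=.
  apply: eq_bigr => i _; rewrite !big_ord_recl big_ord0 /= /bump /= /word /weight.
  by rewrite addbT addbF !addn0 !add1n; case: (odd i) => /=; lia.
by case=> i j _; rewrite -(present_pos D (i, j)); case: present.
Qed.

(** The set with prescribed words: the colour of a cell selects the word, its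
column selects the bit. *)
Definition glue (w : bool -> nat -> letter) : {set grid n 4} :=
  [set x : 'I_n * 'I_4 | let a := w (odd x.1 (+) odd x.2) x.1 in
    if (x.2 == 0 :> nat) || (x.2 == 3 :> nat) then a.1 else a.2].

Lemma word_glue w c i : i < n -> word (glue w) c i = w c i.
Proof.
move=> ltin; have gE j (ltj : j < 4) :
    present (glue w) (i, j) = ((Ordinal ltin, Ordinal ltj) \in glue w).
  exact: (present_pos _ (Ordinal ltin, Ordinal ltj)).
rewrite /word; case: (boolP (odd i (+) c)) => eb /=;
  rewrite !gE !inE /=; case: (odd i) c eb => -[] //= _; by case: (w _ i).
Qed.

End Halves.

Lemma total_dominating_no_isolated (G : sgraph) (D : {set G}) :
  total_dominating D -> no_isolated G.
Proof.
move=> /forallP domD; apply/forallP => x.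
by have /exists_inP[y _ xy] := domD x; apply/existsP; exists y.
Qed.

(** The two words of a total dominating set bound its size below; conversely
optimal words of both colours can be glued together, because the two halves
have disjoint sets of dominators and of targets. *)
Lemma gamma_t_value n (B : {set {set grid n 4}}) k m0 m1 :
    agree B k ->
    value (rows k false n) = Some m0 -> value (rows k true n) = Some m1 ->
  no_isolated (del_edges B) /\ gamma_t (del_edges B) = m0 + m1.
Proof.
move=> Bk v0 v1.
have [w0 f0 c0] := value_attained v0; have [w1 f1 c1] := value_attained v1.
pose w (c : bool) := if c then w1 else w0; pose D := glue n w.
have wD c i : i < n -> word D c i = w c i by apply: word_glue.
have fD c : fits (rows k c n) blank (word D c).
  have /fitsP[wn fw] : fits (rows k c n) blank (w c) by case: c.
  rewrite size_rows in wn fw.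
  have {}wD i : i <= n -> word D c i = w c i.
    by rewrite leq_eqVlt => /orP[/eqP->|/wD //]; rewrite word_out wn.
  apply/fitsP; rewrite size_rows word_out; split=> // i r lti.
  rewrite !wD // 1?ltnW //; have := fw i r lti.
  by case: (i) lti => // j ltj; rewrite wD // ltnW // ltnW.
have domD := fits_dominating Bk fD.
have isoB := total_dominating_no_isolated domD.
split=> //; apply/(gamma_tP _ isoB); split=> [|D' domD'].
  exists D => //; rewrite card_word -c0 -c1 !size_rows.
  by congr (_ + _); apply: eq_bigr => i _; rewrite wD.
rewrite card_word.
have [k0] := value_le (dominating_fits Bk false domD').
have [k1] := value_le (dominating_fits Bk true domD').
by rewrite v0 v1 !size_rows => -[<-] le1 [<-] le0; apply: leq_add.
Qed.

(** * Total domination numbers with prescribed edges removed *)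

Definition open_row : row := (true, true, true, true, (true, true, true)).

Definition plain (n : nat) : option nat := value (nseq n open_row).

Definition kills (L : seq ((nat * nat) * (nat * nat))) : cutting :=
  fun p q => ((p, q) \in L) || ((q, p) \in L).

Definition cut_edges n (L : seq ((nat * nat) * (nat * nat))) :
    {set {set grid n 4}} :=
  edges (grid n 4)
  :&: [set e in [seq [set x : grid n 4 | pos x \in [:: e.1; e.2]] | e <- L]].

Lemma card_cut_edges n L : #|cut_edges n L| <= size L.
Proof.
apply: leq_trans (subset_leq_card (subsetIr _ _)) _.
by rewrite cardsE (leq_trans (card_size _)) ?size_map.
Qed.

Lemma eq_set2_pos n (x y : grid n 4) p q : x != y ->
  ([set x; y] == [set z : grid n 4 | pos z \in [:: p; q]])
    = ((pos x, pos y) == (p, q)) || ((pos y, pos x) == (p, q)).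
Proof.
move=> xy; apply/eqP/idP => [/setP exy|].
  have pxy : pos x != pos y by rewrite (inj_eq (@pos_inj n)).
  have := exy y; have := exy x; rewrite !inE !eqxx orbT !xpair_eqE.
  by move/esym/orP=> [] /eqP ex /esym/orP[] /eqP ey; move: pxy; rewrite ex ey !eqxx ?orbT.
have pE z u : (z == u :> grid n 4) = (pos z == pos u).
  by rewrite (inj_eq (@pos_inj n)).
rewrite !xpair_eqE; case/orP=> /andP[/eqP <- /eqP <-]; apply/setP=> z.
  by rewrite !inE !pE.
by rewrite !inE !pE orbC.
Qed.

Lemma adj_neq (G : sgraph) (x y : G) : adj x y -> x != y.
Proof. by apply: contraTneq => ->; rewrite adj_irrefl. Qed.

Lemma edge_mem (G : sgraph) (x y : G) : adj x y -> [set x; y] \in edges G.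
Proof. by move=> xy; apply/imset2P; exists x y; rewrite ?inE. Qed.

Lemma agree_cut_edges n L : agree (cut_edges n L) (kills L).
Proof.
move=> x y xy; rewrite inE edge_mem // inE /=.
apply/mapP/orP => [[[p q] eL /eqP]|].
  rewrite eq_set2_pos ?(adj_neq xy) //.
  by case/orP=> /eqP[-> ->]; [left|right].
by case=> eL; [exists (pos x, pos y)|exists (pos y, pos x)] => //;
  apply/eqP; rewrite eq_set2_pos ?(adj_neq xy) // eqxx ?orbT.
Qed.

Lemma agree_set1 n (x y : grid n 4) :
  adj x y -> agree [set [set x; y]] (kills [:: (pos x, pos y)]).
Proof.
move=> xy x' y' xy'; rewrite inE.
have -> : [set x; y] = [set z : grid n 4 | pos z \in [:: pos x; pos y]].
  by apply/eqP; rewrite eq_set2_pos ?(adj_neq xy) // eqxx.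
by rewrite eq_set2_pos ?(adj_neq xy') // /kills !inE.
Qed.

Lemma gamma_t_del0 (G : sgraph) :
    no_isolated (del_edges (set0 : {set {set G}})) ->
  gamma_t (del_edges (set0 : {set {set G}})) = gamma_t G.
Proof.
have adjE (x y : G) : del_adj set0 x y = adj x y by rewrite /del_adj inE andbT.
have domE (D : {set G}) :
    total_dominating (G := del_edges set0) D = total_dominating D.
  by apply: eq_forallb => x; apply: eq_existsb => y; rewrite /= adjE.
move=> iso0.
have isoG : no_isolated G.
  by move: iso0; congr is_true; apply: eq_forallb => x; apply: eq_existsb => y;
    rewrite /= adjE.
apply/(gamma_tP _ iso0).
have /(_ (gamma_t G))[[//|[D domD cD] minD] _] := gamma_tP _ isoG.
split; first by exists D; rewrite ?domE.
by move=> D'; rewrite domE; apply: minD.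
Qed.

Lemma gamma_t_grid n m : plain n = Some m -> gamma_t (grid n 4) = m + m.
Proof.
move=> vm.
have rowsE c : rows (fun _ _ => false) c n = nseq n open_row.
  by apply: (@eq_from_nth _ open_row);
    rewrite ?size_rows ?size_nseq // => i lti; rewrite nth_rows // nth_nseq lti.
have agree0 : agree (set0 : {set {set grid n 4}}) (fun _ _ => false).
  by move=> x y _; rewrite inE.
have [||iso0 <-] := gamma_t_value (m0 := m) (m1 := m) agree0; rewrite ?rowsE //.
by rewrite gamma_t_del0.
Qed.

(** The two halves of the intact grid are equal, hence [m + m]. *)
Definition raises L (n : nat) : bool :=
  match value (rows (kills L) false n), value (rows (kills L) true n), plain n with
  | Some m0, Some m1, Some m => m + m < m0 + m1
  | _, _, _ => false
  end.

Lemma cut_edges_bondage n L :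
  raises L n -> total_bondage_set (cut_edges n L).
Proof.
rewrite /raises; case E0: (value _) => [m0|//]; case E1: (value _) => [m1|//].
case E: (plain n) => [m|//] lt.
have [iso g] := gamma_t_value (@agree_cut_edges n L) E0 E1.
by rewrite /total_bondage_set iso g (gamma_t_grid E) lt andbT subsetIl.
Qed.

(** * Removing a single edge *)

(** The constraints with at most one bit missing. *)
Definition row_cuts : seq row :=
  [:: open_row;
      (false, true, true, true, (true, true, true));
      (true, false, true, true, (true, true, true));
      (true, true, false, true, (true, true, true));
      (true, true, true, false, (true, true, true));
      (true, true, true, true, (false, true, true));
      (true, true, true, true, (true, false, true));
      (true, true, true, true, (true, true, false))].

Definition colour (p : nat * nat) : bool := odd p.1 (+) odd p.2.

(** Between a cell [s] and a dominator [y], only the orientation of the removed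
edge that points to its endpoint of colour [c] matters. The alternative [y = s]
covers row 0, where the upward neighbour of [s] is computed as [s] itself. *)
Lemma kills1E c p q s y : colour p = ~~ c -> colour q = c ->
    colour y = c \/ y = s ->
  kills [:: (p, q)] s y = (s == p) && (y == q).
Proof.
move=> cp cq cy; rewrite /kills !inE !xpair_eqE.
case: (altP (y =P p)) => [eyp|_]; last by rewrite orbF.
have eys : y = s by case: cy => //; rewrite eyp cp; case: (c).
by rewrite -eys eyp !eqxx /= orbb.
Qed.

(** Only the row of the target endpoint [p] is affected, and only in one bit,
since the neighbours of a cell are distinct. *)
Lemma row_of_kills1 p q c i : colour p = ~~ c -> colour q = c ->
  row_of (kills [:: (p, q)]) c i \in row_cuts
  /\ (i != p.1 -> row_of (kills [:: (p, q)]) c i = open_row).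
Proof.
move=> cp cq; rewrite /row_of !(kills1E cp cq); last first.
all: try by left; rewrite /colour /=; case: (odd i) c {cp cq} => [] [].
all: try by case: i => [|i]; [right|left; rewrite /colour /= addNb;
  case: (odd i) c {cp cq} => [] []].
case: p q {cp cq} => [i1 j1] [i2 j2]; rewrite !xpair_eqE /=.
split; last by move/negbTE->.
case: eqP => [->|_] /=; last by rewrite !inE.
have excl : ~~ ((i1.-1 == i2) && (i1.+1 == i2)) by lia.
case: (_ (+) _); case: j1 j2 => [|[|[|[|j1]]]] [|[|[|[|j2]]]] //=;
  by case: (i1 == i2) (i1.-1 == i2) (i1.+1 == i2) excl => [] [] [].
Qed.

Lemma nseq_split (T : Type) (x0 : T) (rs : seq T) i x :
    i < size rs -> nth x0 rs i = x ->
    (forall j, j < size rs -> j != i -> nth x0 rs j = x0) ->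
  rs = nseq i x0 ++ x :: nseq (size rs - i.+1) x0.
Proof.
move=> lti <- rs0; rewrite -{1}(cat_take_drop i rs) (drop_nth x0 lti).
congr (_ ++ _ :: _); apply: (@eq_from_nth _ x0).
- by rewrite size_takel ?size_nseq // ltnW.
- move=> j; rewrite size_takel ?(ltnW lti) // => ltj.
  by rewrite nth_take // nth_nseq ltj rs0 ?neq_ltn ?ltj // (ltn_trans ltj).
- by rewrite size_drop size_nseq.
move=> j; rewrite size_drop nth_drop nth_nseq => ltj; rewrite ltj rs0 //; lia.
Qed.

(** In the half of colour [c], the target endpoint of the removed edge is the
one whose colour is not [c]; the other endpoint plays this role in the other
half. *)
Lemma rows_kills1 n p q c : p.1 < n -> q.1 < n -> colour q != colour p ->
  exists i (r : row), [/\ i < n, r \in row_cuts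
    & rows (kills [:: (p, q)]) c n
        = nseq i open_row ++ r :: nseq (n - i.+1) open_row].
Proof.
wlog cp : p q / colour p = ~~ c => [IH|ltp _ cqp].
  case: (altP (colour p =P ~~ c)) => [cp|cp ltp ltq cqp]; first exact: IH.
  have cq : colour q = ~~ c by move: cp cqp; case: (colour p); case: (colour q); case: (c).
  have pq : colour p != colour q by rewrite eq_sym.
  have [i [r [lti rc rE]]] := IH q p cq ltq ltp pq.
  exists i, r; split=> //; rewrite -rE; apply: eq_map => j.
  have killsC s y : kills [:: (p, q)] s y = kills [:: (q, p)] s y.
    by rewrite /kills !inE !xpair_eqE andbC orbC andbC.
  by rewrite /row_of !killsC.
have cq : colour q = c by move: cqp; rewrite cp; case: (colour q); case: (c).
exists p.1, (row_of (kills [:: (p, q)]) c p.1); split=> //.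
  by case: (row_of_kills1 p.1 cp cq).
have := @nseq_split _ open_row (rows (kills [:: (p, q)]) c n) p.1.
rewrite size_rows; apply; rewrite ?nth_rows // => j ltj jp.
by rewrite nth_rows //; case: (row_of_kills1 j cp cq) => _; apply.
Qed.

(** * Periodicity *)

Lemma opt_nseq i r rs : opt (nseq i r ++ rs) = iter i (step r) (opt rs).
Proof. by elim: i => //= i ->. Qed.

(** The table of [k] intact rows at the bottom of the grid. *)
Definition free (k : nat) : table := iter k (step open_row) final.

Lemma plainE k : plain k = start (free k).
Proof. by rewrite /plain /value -[nseq k _]cats0 opt_nseq. Qed.

(** Linearity propagates a single observed coincidence to all later steps. *)
Lemma iter_period m i d (f : table -> table) t :
    (forall u, f (shift d u) = shift d (f u)) ->
    iter (m + i) f t = shift d (iter i f t) ->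
  forall j, i <= j -> iter (m + j) f t = shift d (iter j f t).
Proof.
move=> fS per j /subnKC <-; rewrite addnA addnC iterD per.
have fiS n u : iter n f (shift d u) = shift d (iter n f u).
  by elim: n => //= n ->.
by rewrite fiS -iterD addnC.
Qed.

(** From seven rows on, five more rows cost exactly 3 more cells of each
colour, whatever lies above them: 6 cells of D in five rows. *)
Lemma free_period k : 7 <= k -> free (5 + k) = shift 3 (free k).
Proof.
apply: iter_period => [u|]; first exact: step_shift.
by vm_compute.
Qed.

(** The lengths at which no single edge matters: 4 modulo 5, and the
exceptional length 6. *)
Definition critical (n : nat) : bool := (n %% 5 == 4) || (n == 6).

(** The same period holds above a row with a missing bit, from nine rows on.
Below that row [k] can be taken less than 12 = 7 + 5 by [free_period]. *)
Lemma cut_period r k i : r \in row_cuts -> k < 12 -> 9 <= i ->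
  iter (5 + i) (step open_row) (step r (free k))
    = shift 3 (iter i (step open_row) (step r (free k))).
Proof.
move=> rc ltk; apply: iter_period => [u|]; first exact: step_shift.
have chk : all (fun r => all (fun k =>
    let t := iter 9 (step open_row) (step r (free k)) in
    iter 5 (step open_row) t == shift 3 t) (iota 0 12)) row_cuts.
  by vm_compute.
have /allP/(_ k) := allP chk r rc.
by rewrite mem_iota => /(_ ltk)/eqP; rewrite -iterD.
Qed.

Lemma cut_small r k i : r \in row_cuts -> k < 12 -> i < 14 ->
  critical (i + k.+1) ->
  start (iter i (step open_row) (step r (free k))) = plain (i + k.+1).
Proof.
move=> rc ltk lti crit.
have chk : all (fun r => all (fun k => all (fun i =>
    if critical (i + k.+1) then
      start (iter i (step open_row) (step r (free k))) == plain (i + k.+1)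
    else true) (iota 0 14)) (iota 0 12)) row_cuts.
  by vm_compute.
have /allP/(_ k) := allP chk r rc.
rewrite mem_iota => /(_ ltk)/allP/(_ i); rewrite mem_iota crit.
by move=> /(_ lti)/eqP.
Qed.

(** One missing bit never changes the least weight at a critical length: by the
two periods, five rows can be taken away below the damaged row or above it until
fewer than 12, respectively fewer than 14 = 9 + 5, are left. The length stays
critical, since above 6 only its residue modulo 5 counts. *)
Lemma cut_harmless r i k : r \in row_cuts -> critical (i + k.+1) ->
  value (nseq i open_row ++ r :: nseq k open_row) = plain (i + k.+1).
Proof.
move=> rc; rewrite /value opt_nseq /= -[nseq k _]cats0 opt_nseq -/(free k).
have plainS n : 7 <= n -> plain (5 + n) = oadd 3 (plain n).
  by move=> len; rewrite !plainE free_period // start_shift.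
elim/ltn_ind: k i => k IHk; elim/ltn_ind => i IHi crit.
have [ltk|lek] := ltnP k 12; last first.
  have ek : k = 5 + (k - 5) by lia.
  have en : i + k.+1 = 5 + (i + (k - 5).+1) by lia.
  have crit' : critical (i + (k - 5).+1) by move: crit; rewrite /critical; lia.
  rewrite en plainS -?IHk //; [|lia..].
  by rewrite {1}ek free_period ?step_shift ?iter_step_shift ?start_shift //; lia.
have [lti|lei] := ltnP i 14; first exact: cut_small.
have ei : i = 5 + (i - 5) by lia.
have en : i + k.+1 = 5 + (i - 5 + k.+1) by lia.
have crit' : critical (i - 5 + k.+1) by move: crit; rewrite /critical; lia.
rewrite en plainS -?IHi //; [|lia..].
by rewrite {1}ei cut_period ?start_shift //; lia.
Qed.
(** * The bondage numbers *)

(** The removed edge damages one row in each half, and neither half gets more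
expensive. *)
Lemma single_edge_not_bondage n (e : {set grid n 4}) m :
  critical n -> plain n = Some m -> ~~ total_bondage_set [set e].
Proof.
move=> crit vm; apply/negP => /and3P[/subsetP/(_ e)].
rewrite inE eqxx => /(_ isT)/imset2P[x y _]; rewrite inE => /andP[_ xy] -> _.
rewrite (gamma_t_grid vm).
have cxy : colour (pos y) != colour (pos x).
  move: xy; rewrite /colour /= /grid_adj.
  by case/orP=> /andP[/eqP -> /orP[]/eqP <-] /=; do 2?case: (odd _).
have valE c : value (rows (kills [:: (pos x, pos y)]) c n) = Some m.
  have [i [r [lti rc ->]]] :=
    @rows_kills1 n (pos x) (pos y) c (ltn_ord _) (ltn_ord _) cxy.
  have en : i + (n - i.+1).+1 = n by lia.
  by rewrite cut_harmless ?en.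
have [_ ->] := gamma_t_value (agree_set1 xy) (valE false) (valE true).
by rewrite ltnn.
Qed.

Lemma set0_not_bondage n m :
  plain n = Some m -> ~~ @total_bondage_set (grid n 4) set0.
Proof.
by move=> vm; apply/negP=> /and3P[_ iso0]; rewrite gamma_t_del0 // ltnn.
Qed.

Definition top_rows_only (L : seq ((nat * nat) * (nat * nat))) : bool :=
  all (fun e => (e.1.1 < 2) && (e.2.1 < 2)) L.

Lemma row_of_top L c i : top_rows_only L -> 2 <= i ->
  row_of (kills L) c i = open_row.
Proof.
move=> /allP topL le2i.
have k0 s y : 2 <= s.1 -> kills L s y = false.
  by move=> les; apply/negP=> /orP[] /topL /andP[] /=; lia.
by rewrite /row_of !k0.
Qed.

Lemma opt_rows_top L c n : top_rows_only L ->
  opt (rows (kills L) c n.+2)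
    = step (row_of (kills L) c 0) (step (row_of (kills L) c 1) (free n)).
Proof.
move=> topL; rewrite /free -[final]/(opt [::]) -opt_nseq cats0.
congr (step _ (step _ (opt _))); apply: (@eq_from_nth _ open_row).
  by rewrite size_map size_iota size_nseq.
move=> i; rewrite size_map size_iota => lti.
by rewrite (nth_map 0) ?size_iota // nth_iota // nth_nseq lti row_of_top.
Qed.

(** With all removed edges in the top two rows, the rows below are intact; from
9 = 2 + 7 rows on, they contribute the period. *)
Lemma raises_period L n : top_rows_only L -> 9 <= n ->
  raises L (5 + n) = raises L n.
Proof.
move=> topL; case: n => [|[|n]] // len; rewrite /raises.
have vS c : value (rows (kills L) c (5 + n.+2))
    = oadd 3 (value (rows (kills L) c n.+2)).
  rewrite -[5 + _]/(5 + n).+2 /value !opt_rows_top //.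
  by rewrite free_period // !step_shift start_shift.
rewrite !vS !plainE free_period ?start_shift; last by lia.
case: (value _) (value _) (start _) => [a|] [b|] [m|] //=; lia.
Qed.

(** The claim for all lengths in [P] follows from those below 14 = 9 + 5. *)
Lemma raises_all L (P : pred nat) : top_rows_only L ->
    (forall n, P (5 + n) -> 9 <= n -> P n) ->
    all (fun n => if P n then raises L n else true) (iota 1 13) ->
  forall n, 1 <= n -> P n -> raises L n.
Proof.
move=> topL PS /allP chk; elim/ltn_ind => n IH len Pn.
have [ltn|lenn] := ltnP n 14.
  by have := chk n; rewrite Pn mem_iota; apply; rewrite len.
have en : n = 5 + (n - 5) by lia.
have le9 : 9 <= n - 5 by lia.
rewrite en raises_period //; apply: IH; [lia|lia|].
by apply: PS; rewrite -?en.
Qed.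

Lemma bondage_leW (G : sgraph) (B : {set {set G}}) k :
  total_bondage_set B -> #|B| <= k -> bondage_le (total_bondage G) k.
Proof.
move=> bB leB; case E: (total_bondage G) => [c|] /=.
  by move/total_bondageP: E => [_ minc]; apply: leq_trans (minc _ bB) leB.
by move: E; rewrite /total_bondage; case: pickP => // /(_ B); rewrite bB.
Qed.

Lemma total_bondage_eq (G : sgraph) (B : {set {set G}}) k :
    total_bondage_set B -> #|B| <= k ->
    (forall B' : {set {set G}}, total_bondage_set B' -> k <= #|B'|) ->
  total_bondage G = Some k.
Proof.
move=> bB leB mink; apply/total_bondageP; split=> //.
by exists B => //; apply/eqP; rewrite eqn_leq leB mink.
Qed.

Lemma raises_plain L n : raises L n -> exists m, plain n = Some m.
Proof.
rewrite /raises; case: (value _) => // m0; case: (value _) => // m1.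
by case: (plain n) => // m _; exists m.
Qed.

Definition corner_edge := ((0, 0), (0, 1)).
Definition middle_edge := ((0, 1), (0, 2)).
Definition lower_edge := ((1, 0), (1, 1)).
Definition side_edge := ((0, 3), (1, 3)).

Lemma total_bondage_one n : 1 <= n -> n %% 5 = 1 -> n <> 6 ->
  total_bondage (grid n 4) = Some 1.
Proof.
move=> n1 nmod n6.
have rn : raises [:: middle_edge] n.
  apply: (@raises_all _ (fun n => (n %% 5 == 1) && (n != 6)) _ _ _ n n1).
  - by [].
  - by move=> k; lia.
  - by vm_compute.
  by rewrite nmod; apply/eqP.
apply: total_bondage_eq (cut_edges_bondage rn) (card_cut_edges _ _) _ => B bB.
rewrite card_gt0; apply: contraTneq bB => ->.
by have [m /set0_not_bondage] := raises_plain rn.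
Qed.

Lemma total_bondage_two n : 1 <= n -> critical n ->
  total_bondage (grid n 4) = Some 2.
Proof.
move=> n1 crit.
have rn : raises [:: middle_edge; side_edge] n.
  apply: (@raises_all _ critical _ _ _ n n1 crit).
  - by [].
  - by move=> k; rewrite /critical; lia.
  - by vm_compute.
have [m vm] := raises_plain rn.
apply: total_bondage_eq (cut_edges_bondage rn) (card_cut_edges _ _) _ => B bB.
rewrite ltnNge leq_eqVlt ltnS leqn0; apply: contraL bB.
case/orP=> [/cards1P[e ->]|]; first exact: single_edge_not_bondage crit vm.
by rewrite cards_eq0 => /eqP->; apply: set0_not_bondage vm.
Qed.

Lemma bondage_le_three n : 1 <= n -> n %% 5 = 2 ->
  bondage_le (total_bondage (grid n 4)) 3.
Proof.
move=> n1 nmod.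
have rn : raises [:: middle_edge; corner_edge; lower_edge] n.
  apply: (@raises_all _ (fun n => n %% 5 == 2) _ _ _ n n1).
  - by [].
  - by move=> k; lia.
  - by vm_compute.
  by rewrite nmod.
exact: bondage_leW (cut_edges_bondage rn) (card_cut_edges _ _).
Qed.

Lemma bondage_le_four n : 1 <= n -> n %% 5 = 0 \/ n %% 5 = 3 ->
  bondage_le (total_bondage (grid n 4)) 4.
Proof.
move=> n1 nmod.
have rn : raises [:: middle_edge; corner_edge; lower_edge; side_edge] n.
  apply: (@raises_all _ (fun n => (n %% 5 == 0) || (n %% 5 == 3)) _ _ _ n n1).
  - by [].
  - by move=> k; lia.
  - by vm_compute.
  by apply/orP; case: nmod => ->; [left|right].
exact: bondage_leW (cut_edges_bondage rn) (card_cut_edges _ _).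
Qed.

Theorem theorem5p1 :
  total_bondage (grid 6 4) = Some 2 /\
  forall n : nat, 1 <= n ->
    [/\ n = 1 %[mod 5] -> n <> 6 -> total_bondage (grid n 4) = Some 1,
        n = 4 %[mod 5] -> total_bondage (grid n 4) = Some 2,
        n = 2 %[mod 5] -> bondage_le (total_bondage (grid n 4)) 3
      & n = 0 %[mod 5] \/ n = 3 %[mod 5] ->
          bondage_le (total_bondage (grid n 4)) 4].
Proof.
split=> [|n n1]; first exact: total_bondage_two.
split; first exact: total_bondage_one.
- by move=> nmod; apply: total_bondage_two => //; rewrite /critical nmod.
- exact: bondage_le_three.
exact: bondage_le_four.
Qed.
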